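(* Let $G$ be a finite group, let $I$ and $\Lambda$ be finite (non-empty) index sets, and let $P=(p_{\lambda i})$ be a regular $\Lambda\times I$ matrix with entries in $G^0$ that contains at least one zero entry. Suppose that $\mathcal{G}(\mathcal{M}_0[G;I,\Lambda;P])$ is not connected. Then $\overline{P}$ is $\leftrightarrow$-equivalent to a block matrix of one of the following forms, where for each $k\in\{1,\ldots,n\}$ the matrix $A_k$ is a $0$-closure submatrix of $P$, and every block other than the blocks $\overline{A_1},\ldots,\overline{A_n}$ has all its entries equal to $\times$: (i) the matrix with diagonal blocks $\overline{A_1},\ldots,\overline{A_n}$ and all off-diagonal blocks filled with $\times$, with $n\geqslant 2$; (ii) the matrix as in (i), but with $n\geqslant 1$, together with one additional (non-empty) block of columns on the right, all of whose entries are $\times$; (iii) the matrix as in (i), but with $n\geqslant 1$, together with one additional (non-empty) block of rows at the bottom, all of whose entries are $\times$; (iv) the matrix as in (i), but with $n\geqslant 1$, together with both an additional (non-empty) block of columns on the right and an additional (non-empty) block of rows at the bottom, all of whose entries are $\times$. Moreover, the connected components of $\mathcal{G}(\mathcal{M}_0[G;I,\Lambda;P])$ can be identified in the following way: (1) Let $k\in\{1,\ldots,n\}$ and suppose that $A_k=P[\Lambda_k|I_k]$. Then the subgraph of $\mathcal{G}(\mathcal{M}_0[G;I,\Lambda;P])$ induced by $I_k\times G\times\Lambda_k$ is a connected component of $\mathcal{G}(\mathcal{M}_0[G;I,\Lambda;P])$. (2) Let $k,m\in\{1,\ldots,n\}$ with $k\neq m$ and suppose that $A_k=P[\Lambda_k|I_k]$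 and $A_m=P[\Lambda_m|I_m]$. Then the subgraph induced by $(I_k\times G\times\Lambda_m)\cup(I_m\times G\times\Lambda_k)$ is a connected component of $\mathcal{G}(\mathcal{M}_0[G;I,\Lambda;P])$. (3) Let $i\in I$ and let $\lambda\in\Lambda$ be such that row $\lambda$ of $P$ has no zero entries. Then the subgraph induced by $\{i\}\times G\times\{\lambda\}$ is a connected component of $\mathcal{G}(\mathcal{M}_0[G;I,\Lambda;P])$. (4) Let $\lambda\in\Lambda$ and let $i\in I$ be such that column $i$ of $P$ has no zero entries. Then the subgraph induced by $\{i\}\times G\times\{\lambda\}$ is a connected component of $\mathcal{G}(\mathcal{M}_0[G;I,\Lambda;P])$.
   Context: $G^0=G\cup\{0\}$ is $G$ with a zero adjoined. A matrix over $G^0$ is regular if every row and every column contains a non-zero entry. The $0$-Rees matrix semigroup $\mathcal{M}_0[G;I,\Lambda;P]$ is the set $(I\times G\times\Lambda)\cup\{0\}$ with $(i,x,\lambda)(j,y,\mu)=(i,xp_{\lambda j}y,\mu)$ if $p_{\lambda j}\neq 0$, $(i,x,\lambda)(j,y,\mu)=0$ if $p_{\lambda j}=0$, and all products involving $0$ equal to $0$. The commuting graph $\mathcal{G}(S)$ of a finite non-commutative semigroup $S$ is the simple graph with vertex set $S\setminus Z(S)$ ($Z(S)$ the center), where distinct $x,y$ are adjacent iff $xy=yx$. (When $P$ is regular and has a zero entry, $\mathcal{M}_0[G;I,\Lambda;P]$ is non-commutative with center $\{0\}$, so the vertex set is $I\times G\times\Lambda$.) $\overline{P}$ is the matrix obtained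 from $P$ by replacing each non-zero entry by the symbol $\times$ (zero entries are kept). Two matrices are $\leftrightarrow$-equivalent if one is obtained from the other by permuting rows and/or columns. For $I'\subseteq I$, $\Lambda'\subseteq\Lambda$, $P[\Lambda'|I']$ is the submatrix of $P$ with rows indexed by $\Lambda'$ and columns by $I'$. In the block forms, the rows (columns) of the blocks $\overline{A_1},\ldots,\overline{A_n}$ correspond to the rows (columns) of $P$ indexed by pairwise disjoint sets $\Lambda_1,\ldots,\Lambda_n$ ($I_1,\ldots,I_n$), where $A_k=P[\Lambda_k|I_k]$, and additional blocks correspond to the remaining rows/columns. $0$-closure method: let $p_{\lambda i}=0$. Put $I_0=\{i\}$, $\Lambda_0=\{\lambda\}$ and, for $k\ge 0$, $I_{k+1}=I_k\cup\{j\in I: p_{\mu j}=0\text{ for some }\mu\in\Lambda_k\}$ and $\Lambda_{k+1}=\Lambda_k\cup\{\mu\in\Lambda: p_{\mu j}=0\text{ for some }j\in I_k\}$. Let $\zeta(\lambda,i)$ be the least $k$ with $I_{k+1}=I_k$ and $\Lambda_{k+1}=\Lambda_k$. The $0$-closure $(\lambda,i)$-submatrix of $P$ is $P[\Lambda_k|I_k]$ with $k=\zeta(\lambda,i)$. A $0$-closure submatrix of $P$ is a $0$-closure $(\lambda,i)$-submatrix for some $(\lambda,i)$ with $p_{\lambda i}=0$. (The sets $I_k,\Lambda_k$ of this paragraph are local to the method.) *)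

(* Defs.v *)
From mathcomp Require Import all_boot all_fingroup.

Set Implicit Arguments.
Unset Strict Implicit.
Unset Printing Implicit Defensive.

Record finSemigroup := FinSemigroup {
  semigroup_sort :> finType;
  semigroup_mul : semigroup_sort -> semigroup_sort -> semigroup_sort;
  semigroup_mulA : associative semigroup_mul
}.

Section CommutingGraph.
Variable S : finSemigroup.
Local Notation "x ** y" := (semigroup_mul x y) (at level 40).
Implicit Types (x y : S) (C : {set S}).

Definition semigroup_center : {set S} :=
  [set x | [forall y, x ** y == y ** x]].

Definition commuting_vertices : {set S} := ~: semigroup_center.

Definition commuting_adj : rel S := fun x y =>
  [&& x \in commuting_vertices, y \in commuting_vertices, x != y
    & x ** y == y ** x].

Definition commuting_graph_connected : Prop :=
  {in commuting_vertices &, forall x y, connect commuting_adj x y}.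

(* A connected component is represented by its vertex set: the component is
   the subgraph induced by C. *)
Definition is_commuting_component C : Prop :=
  exists2 x, x \in commuting_vertices
    & C = [set y in commuting_vertices | connect commuting_adj x y].

End CommutingGraph.

Section ReesMatrixSemigroup.
Variables (gT : finGroupType) (I Lambda : finType).

(* Matrices with rows indexed by Lambda, columns indexed by I and entries in
   the group with zero adjoined; the adjoined zero is None. *)
Definition regular_matrix (P : Lambda -> I -> option gT) : Prop :=
  (forall l, exists i, P l i <> None) /\ (forall i, exists l, P l i <> None).

Variable P : Lambda -> I -> option gT.

(* The zero of the semigroup is None. *)
Definition rees0_mul (a b : option (I * gT * Lambda)) :
    option (I * gT * Lambda) :=
  match a, b with
  | Some (i, x, l), Some (j, y, m) =>
      if P l j is Some p then Some (i, (x * p * y)%g, m) else None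
  | _, _ => None
  end.

Fact rees0_mulA : associative rees0_mul.
Proof.
move=> [[[i x] l]|] [[[j y] m]|] [[[k z] q]|] //=.
- by case Emk: (P m k) => [p|]; case Elj: (P l j) => [p'|] //=;
    rewrite ?Elj ?Emk ?mulgA.
- by case: (P l j).
Qed.

Definition rees0 : finSemigroup := FinSemigroup rees0_mulA.

(* The set J x G x L of non-zero elements. *)
Definition rees0_block (J : {set I}) (L : {set Lambda}) : {set rees0} :=
  [set a : rees0 | if a is Some (i, _, l) then (i \in J) && (l \in L)
                   else false].

End ReesMatrixSemigroup.

Section ZeroClosure.
Variables (gT : finGroupType) (I Lambda : finType).
Variable P : Lambda -> I -> option gT.

Definition zero_closure_step (X : {set I} * {set Lambda}) :
    {set I} * {set Lambda} :=
  (X.1 :|: [set j | [exists mu in X.2, P mu j == None]],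
   X.2 :|: [set mu | [exists j in X.1, P mu j == None]]).

Definition zero_closure_iter (l : Lambda) (i : I) (k : nat) :
    {set I} * {set Lambda} :=
  iter k zero_closure_step ([set i], [set l]).

Definition zero_closure_stable (l : Lambda) (i : I) (k : nat) : bool :=
  zero_closure_iter l i k.+1 == zero_closure_iter l i k.

Fact zero_closure_stable_ex (l : Lambda) (i : I) :
  exists k, zero_closure_stable l i k.
Proof.
pose sz X : nat := #|(X : {set I} * {set Lambda}).1| + #|X.2|.
have step X : zero_closure_step X != X -> sz X < sz (zero_closure_step X).
  case: X => A B; rewrite /sz /zero_closure_step /=.
  set A' := [set j | _]; set B' := [set j | _].
  have sA : A \subset A :|: A' by apply: subsetUl.
  have sB : B \subset B :|: B' by apply: subsetUl.
  rewrite xpair_eqE negb_and => /orP[neq|neq].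
    rewrite -addSn leq_add ?subset_leq_card ?proper_card //.
    by rewrite properEneq eq_sym neq.
  rewrite -addnS leq_add ?subset_leq_card ?proper_card //.
  by rewrite properEneq eq_sym neq.
pose N := #|I| + #|Lambda|.
case: (boolP [exists k : 'I_N.+1, zero_closure_stable l i k]).
  by case/existsP=> k; exists k.
rewrite negb_exists => /forallP nst.
have grow k : k <= N.+1 -> k <= sz (zero_closure_iter l i k).
  elim: k => // k IHk ltk; apply: leq_ltn_trans (IHk (ltnW ltk)) _.
  exact/step/(nst (Ordinal ltk)).
have := leq_trans (grow _ (leqnn _))
  (leq_add (max_card _) (max_card _) : sz _ <= N).
by rewrite ltnn.
Qed.

Definition zero_closure_zeta (l : Lambda) (i : I) : nat :=
  ex_minn (zero_closure_stable_ex l i).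

Definition zero_closure (l : Lambda) (i : I) : {set I} * {set Lambda} :=
  zero_closure_iter l i (zero_closure_zeta l i).

(* A submatrix P[L|J] is identified by its set L of rows and its set J of
   columns. *)
Definition is_zero_closure_submatrix (L : {set Lambda}) (J : {set I}) : Prop :=
  exists l i, P l i = None /\ (J, L) = zero_closure l i.

End ZeroClosure.

Section BlockForms.

Definition submatrix (T : Type) (I Lambda : finType) (M : Lambda -> I -> T)
    (L : {set Lambda}) (J : {set I}) :
    {l : Lambda | l \in L} -> {i : I | i \in J} -> T :=
  fun a b => M (val a) (val b).
Arguments submatrix {T I Lambda} M L J _ _.

(* Entries of the barred matrix: None is 0 and Some tt is the symbol times. *)
Definition bar (gT I Lambda : Type) (M : Lambda -> I -> option gT) :
    Lambda -> I -> option unit :=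
  fun l i => omap (fun _ => tt) (M l i).

(* Matrices have arbitrary index types here, so permuting rows and columns of M
   amounts to reindexing M along bijections; f and g send each row and column
   of N to the row and column of M that it comes from. *)
Definition row_col_permuted (T R C R' C' : Type) (M : R -> C -> T)
    (N : R' -> C' -> T) (f : R' -> R) (g : C' -> C) : Prop :=
  [/\ bijective f, bijective g & forall a b, N a b = M (f a) (g b)].

(* The block matrix with diagonal blocks A_0, ..., A_(n-1), followed by r
   additional rows and c additional columns; every entry outside the diagonal
   blocks is x. *)
Definition block_matrix (T : Type) (n r c : nat) (R C : 'I_n -> Type)
    (A : forall k, R k -> C k -> T) (x : T) :
    {k : 'I_n & R k} + 'I_r -> {k : 'I_n & C k} + 'I_c -> T :=
  fun a b =>
    match a, b with
    | inl u, inl v => untag x (A (tag u) (tagged u)) v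
    | _, _ => x
    end.

(* The four conditions correspond, in order, to: no additional rows or columns;
   additional columns only; additional rows only; both. *)
Definition block_form (n r c : nat) : Prop :=
  [\/ [/\ 1 < n, r = 0 & c = 0],
      [/\ 0 < n, r = 0 & 0 < c],
      [/\ 0 < n, 0 < r & c = 0]
    | [/\ 0 < n, 0 < r & 0 < c]].

Variables (gT : finGroupType) (I Lambda : finType).

(* The barred P can be permuted into the block matrix with diagonal blocks the
   barred P[Ls k|Js k], the rows and columns of the k-th block being those of P
   indexed by Ls k and Js k. *)
Definition zero_closure_block_decomposition (P : Lambda -> I -> option gT)
    (n r c : nat) (Ls : 'I_n -> {set Lambda}) (Js : 'I_n -> {set I}) : Prop :=
  [/\ forall k, is_zero_closure_submatrix P (Ls k) (Js k),
      forall k m, k != m -> [disjoint Ls k & Ls m] /\ [disjoint Js k & Js m]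
    & exists f g,
      [/\ row_col_permuted (bar P)
            (@block_matrix _ n r c _ _
               (fun k => bar (submatrix P (Ls k) (Js k))) (Some tt))
            f g,
          forall k a, f (inl (existT _ k a)) = val a
        & forall k b, g (inl (existT _ k b)) = val b]].

End BlockForms.

(* Main.v *)
(* View the zero entries of P as the edges of a bipartite graph on columns and
   rows; the 0-closure submatrices are its connected components with at least
   one edge.  Distinct elements (i, x, l) and (j, y, m) commute with product
   zero exactly when l - j and m - i are both edges, so on non-isolated indices
   the commuting graph behaves like the tensor square of this bipartite graph
   modulo swapping the two factors, whose components are indexed by unordered
   pairs of components of the bipartite graph.  If i or l is isolated, then
   (i, x, l) commutes only with elements of the same cell {i} x G x {l}, all of
   which commute with (i, p^-1, l), where p is the (l, i) entry of P. *)

Require Import Defs.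
From mathcomp Require Import all_boot all_fingroup.

Set Implicit Arguments.
Unset Strict Implicit.
Unset Printing Implicit Defensive.

Lemma connect_ind (T : finType) (e : rel T) (Q : T -> Prop) (x : T) :
  Q x -> (forall y z, Q y -> e y z -> Q z) -> forall y, connect e x y -> Q y.
Proof.
move=> Qx Qe y /connectP[p + ->]; elim: p x Qx => //= z p IHp x Qx.
by case/andP=> exz; apply: IHp; apply: Qe exz.
Qed.

(** * Indexing a finite set by disjoint blocks and a remainder *)

Section BlockIndexing.
Variables (T : finType) (n : nat) (B : 'I_n -> {set T}).

(** The domain has the shape of the index types of [block_matrix], so the same function supplies
    both the row and the column permutation. *)
Definition block_index (a : {k : 'I_n & {t | t \in B k}} +
    'I_(#|~: \bigcup_k B k|)) : T :=
  match a with inl u => val (tagged u) | inr j => enum_val j end.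

Lemma block_index_bij :
  (forall k m, k != m -> [disjoint B k & B m]) -> bijective block_index.
Proof.
move=> disB.
have notB j k : enum_val (j : 'I_(#|~: \bigcup_k B k|)) \notin B k.
  have := enum_valP j; rewrite inE; apply: contra => jBk.
  by apply/bigcupP; exists k.
apply: inj_card_bij.
  case=> [[k [s sBk]]|j] [[m [t tBm]]|j'] /= eq_st.
  - subst t; have eq_km : k = m.
      apply/eqP/negPn/negP=> /disB/disjointFr/(_ sBk).
      by rewrite tBm.
    by subst m; rewrite (bool_irrelevance sBk tBm).
  - by case/negP: (notB j' k); rewrite -eq_st.
  - by case/negP: (notB j m); rewrite eq_st.
  - by congr inr; apply: enum_val_inj.
apply: leq_trans (leq_image_card block_index _).
apply/subset_leq_card/subsetP=> t _.
have [/bigcupP[k _ tBk]|tB] := boolP (t \in \bigcup_k B k).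
  by apply/imageP; exists (inl (existT _ k (exist _ t tBk))).
have tC : t \in ~: \bigcup_k B k by rewrite inE.
by apply/imageP; exists (inr (enum_rank_in tC t)); rewrite //= enum_rankK_in.
Qed.

End BlockIndexing.

(** * Zero closures as components of a bipartite graph *)

Section ZeroGraph.
Variables (gT : finGroupType) (I Lambda : finType).
Variable P : Lambda -> I -> option gT.
Implicit Types (i j : I) (l m : Lambda) (u v : I + Lambda).

(* The bipartite graph on columns and rows whose edges are the zero entries of
   P; 0-closures of zero entries are its connected components with at least
   one edge. *)
Definition zero_graph : rel (I + Lambda) := fun u v =>
  match u, v with
  | inl i, inr l | inr l, inl i => P l i == None
  | _, _ => false
  end.

Definition meets_zero u : bool := [exists v, zero_graph u v].

Lemma zero_graph_sym : connect_sym zero_graph.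
Proof. by apply: sym_connect_sym => -[i|l] [j|m]. Qed.

Lemma meets_zero_col i : reflect (exists l, P l i = None) (meets_zero (inl i)).
Proof.
apply: (iffP existsP) => [[[j|l]] //= /eqP|[l /eqP]]; first by exists l.
by exists (inr l).
Qed.

Lemma meets_zero_row l : reflect (exists i, P l i = None) (meets_zero (inr l)).
Proof.
apply: (iffP existsP) => [[[i|m]] //= /eqP|[i /eqP]]; first by exists i.
by exists (inl i).
Qed.

Lemma meets_zero_connect u v :
  meets_zero u -> connect zero_graph u v -> meets_zero v.
Proof.
move=> zu; move: v; apply: connect_ind => // {zu}u' v' _ e_uv.
by apply/existsP; exists u'; case: u' v' e_uv => [i|l] [j|m].
Qed.

(** The iterates stay in the component of [i] because [l] is a neighbour of [i]; conversely, the
    stable iterate contains [i] and is closed under edges. *)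
Lemma zero_closure_connect l i : P l i = None ->
  (forall j, (j \in (zero_closure P l i).1) =
     connect zero_graph (inl i) (inl j)) /\
  (forall m, (m \in (zero_closure P l i).2) =
     connect zero_graph (inl i) (inr m)).
Proof.
move=> Pli0.
pose inC (X : {set I} * {set Lambda}) u :=
  match u with inl j => j \in X.1 | inr m => m \in X.2 end.
have sub k u : inC (zero_closure_iter P l i k) u -> connect zero_graph (inl i) u.
  elim: k u => [|k IHk] u.
    case: u => [j|m] /=; rewrite inE => /eqP->; first exact: connect0.
    by apply: connect1; rewrite /= Pli0.
  rewrite /zero_closure_iter iterS; set X := iter k _ _.
  case: u => [j|m] /=; rewrite !inE => /orP[uX|/existsP[w]].
  - exact: (IHk (inl j)).
  - case/andP=> /(IHk (inr _)) iw Pwj.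
    by apply: connect_trans iw (connect1 _).
  - exact: (IHk (inr m)).
  - case/andP=> /(IHk (inl _)) iw Pwj.
    by apply: connect_trans iw (connect1 _).
have mono k u : inC (zero_closure_iter P l i 0) u ->
    inC (zero_closure_iter P l i k) u.
  elim: k => // k IHk /IHk; rewrite /zero_closure_iter iterS.
  by case: u {IHk} => [j|m] /=; rewrite inE => ->.
have eqC u : inC (zero_closure P l i) u = connect zero_graph (inl i) u.
  apply/idP/idP=> [|]; first exact: sub.
  rewrite /zero_closure /zero_closure_zeta.
  case: ex_minnP => k /eqP stk _; move: u; apply: connect_ind => [|u v].
    by apply: mono; rewrite /= inE.
  (* By stability, [v] may be sought in the next iterate, which absorbs all neighbours of [u]. *)
  rewrite -{2}stk /zero_closure_iter iterS; case: (iter k _ _) => A B.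
  case: u v => [j|m] [j'|m'] //= uX Euv; rewrite !inE; apply/orP; right;
    apply/existsP.
    by exists j; rewrite uX.
  by exists m; rewrite uX.
by split=> u; [rewrite -(eqC (inl u)) | rewrite -(eqC (inr u))].
Qed.

Lemma zero_closure_submatrix_connect L J : is_zero_closure_submatrix P L J ->
  exists i l, [/\ P l i = None,
    forall j, (j \in J) = connect zero_graph (inl i) (inl j)
    & forall m, (m \in L) = connect zero_graph (inl i) (inr m)].
Proof.
case=> l [i [Pli0 eqJL]]; exists i, l; have [] := zero_closure_connect Pli0.
by rewrite -eqJL.
Qed.

End ZeroGraph.

(** * Adjacency and connectivity in the commuting graph *)

Section Commuting.
Variables (gT : finGroupType) (I Lambda : finType).
Variable P : Lambda -> I -> option gT.
Hypothesis P_regular : regular_matrix P.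
Hypothesis P_zero : exists l i, P l i = None.
Implicit Types (i j : I) (l m : Lambda) (x y : gT) (a b : rees0 P).

Local Notation zconn := (connect (zero_graph P)).
Local Notation cconn := (connect (@commuting_adj (rees0 P))).
Local Notation elt i x l := (Some (i, x, l) : rees0 P).

Lemma rees0_commuteP i x l j y m :
  (semigroup_mul (elt i x l) (elt j y m) =
     semigroup_mul (elt j y m) (elt i x l)) <->
  (P l j = None /\ P m i = None) \/
  (exists p, [/\ i = j, l = m, P l i = Some p & x * p * y = y * p * x])%g.
Proof.
rewrite /=; split.
  case Plj: (P l j) => [p|]; case Pmi: (P m i) => [q|] //; last by left.
  case=> eq_ij; subst j => eq_xy eq_lm; subst m; right; exists p.
  by move: Pmi eq_xy; rewrite Plj => -[<-].
case=> [[-> ->] //|[p [<- <- -> ->]]//].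
Qed.

(** If [(i, x, l)] were central, testing it against [(k, 1, m)] with [P l k] non-zero would give
    [m = l] for every [m]. With a single row, a zero entry would fill its column, against
    regularity. *)
Lemma rees0_vertices a :
  (a \in commuting_vertices (rees0 P)) = (a != None :> option _).
Proof.
rewrite !inE; case: a => [[[i x] l]|] /=; last first.
  by apply/negbTE; rewrite negbK; apply/forallP=> -[[[j y] m]|].
apply/negP=> /forallP comm; have [rowP colP] := P_regular.
have [k Plk] := rowP l.
have eqL m : m = l.
  have /eqP/rees0_commuteP[[]//|[p [_ -> //]]] := comm (elt k 1%g m).
have [m [j Pmj]] := P_zero; have [m' Pmj'] := colP j.
by apply: Pmj'; rewrite (eqL m') -(eqL m).
Qed.

Lemma elt_vertex i x l : elt i x l \in commuting_vertices (rees0 P).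
Proof. by rewrite rees0_vertices. Qed.

Lemma cconn_zero i x l j y m : P l j = None -> P m i = None ->
  cconn (elt i x l) (elt j y m).
Proof.
move=> Plj Pmi; have [->|neq] := eqVneq (elt i x l) (elt j y m).
  exact: connect0.
apply: connect1; rewrite /commuting_adj !elt_vertex neq /=.
by rewrite Plj Pmi.
Qed.

Lemma cconn_col i x l j y : meets_zero P (inl i) -> meets_zero P (inr l) ->
  zconn (inl i) (inl j) -> cconn (elt i x l) (elt j y l).
Proof.
move=> /meets_zero_col[l0 Pl0i] /meets_zero_row[i0 Pli0] ij.
(* The column coordinate follows the path while the row coordinate bounces along an edge at [l].
   After an odd number of steps the two have swapped roles, whence the clause for rows. *)
pose Q u := match u with
  | inl j => forall y, cconn (elt i x l) (elt j y l)
  | inr m => forall k y, P l k = None -> cconn (elt i x l) (elt k y m) end.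
suff: Q (inl j) by apply.
move: (inl j) ij => u; apply: connect_ind => {j y u} [|[j|m] [j'|m']] //=.
- by move=> y; apply: (connect_trans (y := elt i0 1%g l0)); apply: cconn_zero.
- move=> Qj /eqP Pm'j k y Plk; apply: connect_trans (Qj 1%g) _.
  exact: cconn_zero.
- move=> Qm /eqP Pmj' y; apply: connect_trans (Qm i0 1%g Pli0) _.
  exact: cconn_zero.
Qed.

(** Move the column to a neighbour [k] of [m], take one commuting step to [(k', 1, m)] with [k'] a
    neighbour of [l], then move [k'] to [j]. *)
Lemma cconn_cross i x l j y m : meets_zero P (inl i) -> meets_zero P (inr l) ->
  zconn (inl i) (inr m) -> zconn (inr l) (inl j) ->
  cconn (elt i x l) (elt j y m).
Proof.
move=> zi zl im lj; have [l0 Pl0i] := meets_zero_col _ _ zi.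
have [k Pmk] := meets_zero_row _ _ (meets_zero_connect zi im).
have ik : zconn (inl i) (inl k).
  by apply: connect_trans im (connect1 _); rewrite /= Pmk.
apply: connect_trans (cconn_col x 1%g zi zl ik) _.
have [m' Pm'j] := meets_zero_col _ _ (meets_zero_connect zl lj).
have [k' Plk'] := meets_zero_row _ _ zl.
apply: (connect_trans (y := elt k' 1%g m)); first exact: cconn_zero.
apply: cconn_col.
- by apply/meets_zero_col; exists l.
- by apply/meets_zero_row; exists k.
- apply: connect_trans lj.
  by apply: connect1; rewrite /= Plk'.
Qed.

(* On non-isolated indices the commuting graph is the tensor square of the zero
   graph, restricted to (column, row) pairs and taken modulo swapping; hence
   two parallel or two crossing walks are needed. *)
Definition same_cell i l j m : bool :=
  zconn (inl i) (inl j) && zconn (inr l) (inr m) ||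
  zconn (inl i) (inr m) && zconn (inr l) (inl j).

Lemma cconn_same_cell i x l j y m :
  meets_zero P (inl i) -> meets_zero P (inr l) ->
  same_cell i l j m -> cconn (elt i x l) (elt j y m).
Proof.
move=> zi zl /orP[]/andP[im lj]; last exact: cconn_cross.
have [l0 Pl0i] := meets_zero_col _ _ zi; have [k Plk] := meets_zero_row _ _ zl.
(* One commuting step swaps the roles of the coordinates and turns parallel walks into crossing
   ones. *)
apply: (connect_trans (y := elt k 1%g l0)); first exact: cconn_zero.
apply: cconn_cross.
- by apply/meets_zero_col; exists l.
- by apply/meets_zero_row; exists i.
- by apply: connect_trans lj; apply: connect1; rewrite /= Plk.
- by apply: connect_trans im; apply: connect1; rewrite /= Pl0i.
Qed.

Lemma cconnP i x l b : meets_zero P (inl i) -> meets_zero P (inr l) ->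
  cconn (elt i x l) b = if b is Some (j, _, m) then same_cell i l j m else false.
Proof.
move=> zi zl; apply/idP/idP; last first.
  by case: b => [[[j y] m]|] //; apply: cconn_same_cell.
move: b; apply: connect_ind; first by rewrite /same_cell !connect0.
case=> [[[j y] m]|] [[[k z] q]|] //= jm; last first.
  by rewrite /commuting_adj !rees0_vertices.
case/and4P=> _ _ _ /eqP/rees0_commuteP[[Pmk Pqj]|[p [<- <- //]]].
have jq : zconn (inl j) (inr q) by apply: connect1; rewrite /= Pqj.
have mk : zconn (inr m) (inl k) by apply: connect1; rewrite /= Pmk.
(* A step with product zero exchanges the parallel and the crossing alternative, so their
   disjunction is invariant. *)
rewrite /same_cell orbC; case/orP: jm => /andP[ij lm].
  by rewrite (connect_trans ij jq) (connect_trans lm mk).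
by rewrite (connect_trans ij mk) (connect_trans lm jq) orbT.
Qed.

Lemma cconn_isolatedP i x l b :
  ~~ (meets_zero P (inl i) && meets_zero P (inr l)) ->
  cconn (elt i x l) b = (b \in rees0_block P [set i] [set l]).
Proof.
move=> iso; rewrite inE; apply/idP/idP.
  move: b; apply: connect_ind; first by rewrite !inE !eqxx.
  case=> [[[j y] m]|] [[[k z] q]|] //=; last first.
    by rewrite /commuting_adj !rees0_vertices.
  rewrite !inE => /andP[/eqP-> /eqP->] /and4P[_ _ _ /eqP].
  case/rees0_commuteP=> [[Plk Pqi]|[p [<- <- _]]]; last by rewrite !eqxx.
  (* A zero product would put a zero in both column [i] and row [l]. *)
  case/negP: iso; apply/andP.
  by split; [apply/meets_zero_col; exists q|apply/meets_zero_row; exists k].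
case: b => [[[j y] m]|] //; rewrite !inE => /andP[/eqP-> /eqP->] {j m}.
have [p Pli] : exists p, P l i = Some p.
  case Pli: (P l i) => [p|]; first by exists p.
  case/negP: iso; apply/andP.
  by split; [apply/meets_zero_col; exists l|apply/meets_zero_row; exists i].
(* In the group law (x, y) |-> x * p * y the identity is p^-1. *)
have step z w : (z * p * w = w * p * z)%g -> cconn (elt i z l) (elt i w l).
  move=> comm; have [->|neq] := eqVneq z w; first exact: connect0.
  apply: connect1; apply/and4P; split; try exact: elt_vertex.
    by apply: contraNneq neq => -[->].
  by apply/eqP/rees0_commuteP; right; exists p.
apply: (connect_trans (y := elt i p^-1%g l)); apply: step;
  by rewrite mulgK mulVg mul1g.
Qed.

End Commuting.

(** * The block decomposition and the list of components *)

Section Decomposition.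
Variables (gT : finGroupType) (I Lambda : finType).
Variable P : Lambda -> I -> option gT.
Implicit Types (i j : I) (l : Lambda).

Local Notation zconn := (connect (zero_graph P)).

Lemma zero_closure_decomposition_exists :
  exists (n r c : nat) (Ls : 'I_n -> {set Lambda}) (Js : 'I_n -> {set I}),
    zero_closure_block_decomposition P r c Ls Js.
Proof.
pose rt := root (zero_graph P).
have symE := zero_graph_sym P.
(* Blocks are numbered by the roots of the components with an edge; roots of rows suffice, since
   every edge has a row as an endpoint. *)
pose W := [set rt (inr l) | l in [set l | meets_zero P (inr l)]].
pose Ls (k : 'I_#|W|) := [set l | rt (inr l) == enum_val k].
pose Js (k : 'I_#|W|) := [set i | rt (inl i) == enum_val k].
have zero_block l i : P l i = None -> exists k, l \in Ls k /\ i \in Js k.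
  move=> Pli; have lW : rt (inr l) \in W.
    by apply: imset_f; rewrite inE; apply/meets_zero_row; exists i.
  exists (enum_rank_in lW (rt (inr l))); rewrite !inE enum_rankK_in // eqxx.
  by split=> //; apply/eqP/(rootP symE)/connect1; rewrite /= Pli.
have disL k m : k != m -> [disjoint Ls k & Ls m].
  move=> neq; rewrite disjoint_subset; apply/subsetP=> l; rewrite !inE.
  by move/eqP->; rewrite (inj_eq enum_val_inj).
have disJ k m : k != m -> [disjoint Js k & Js m].
  move=> neq; rewrite disjoint_subset; apply/subsetP=> i; rewrite !inE.
  by move/eqP->; rewrite (inj_eq enum_val_inj).
exists #|W|, #|~: \bigcup_k Ls k|, #|~: \bigcup_k Js k|, Ls, Js; split.
- move=> k; have /imsetP[l lz eq_k] := enum_valP k.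
  move: lz; rewrite inE => /meets_zero_row[i Pli]; exists l, i; split=> //.
  have [colE rowE] := zero_closure_connect Pli.
  have il : zconn (inl i) (inr l) by apply: connect1; rewrite /= Pli.
  rewrite [RHS]surjective_pairing; congr pair; apply/setP=> t.
    by rewrite colE inE eq_k (root_connect symE) (same_connect symE il) symE.
  by rewrite rowE inE eq_k (root_connect symE) (same_connect symE il) symE.
- by move=> k m neq; split; [apply: disL | apply: disJ].
exists (@block_index _ _ Ls), (@block_index _ _ Js); split=> //.
split; [exact: block_index_bij | exact: block_index_bij |].
(* A zero entry has its row and column in a common block, so all entries outside the diagonal blocks
   are [Some tt]. *)
have nonzero l i : (forall k, l \in Ls k -> i \in Js k -> False) ->
    Some tt = bar P l i.
  rewrite /bar; case Pli: (P l i) => [p|] // noblock.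
  by have [k [lk ik]] := zero_block _ _ Pli; case: (noblock k).
have compl (T : finType) (B : 'I_#|W| -> {set T})
    (t : 'I_(#|~: \bigcup_k B k|)) k : enum_val t \in B k -> False.
  move=> tB; have := enum_valP t; rewrite inE => /bigcupP[].
  by exists k.
case=> [[k [l lk]]|s] [[m [i im]]|t] /=.
- have [eq_mk|neq] := eqVneq m k; last first.
    rewrite untag_dflt //; apply: nonzero => q lq iq.
    have [eq_kq|/disL/disjointFr/(_ lk)] := eqVneq k q; last by rewrite lq.
    by move: neq; rewrite eq_kq => /disJ/disjointFr/(_ im); rewrite iq.
  by subst m; rewrite /untag; case: eqP => //= e;
    rewrite (eq_irrelevance e erefl).
- by apply: nonzero => q _; apply: compl.
- by apply: nonzero => q sq _; apply: compl sq.
- by apply: nonzero => q _; apply: compl.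
Qed.

Variables (n r c : nat) (Ls : 'I_n -> {set Lambda}) (Js : 'I_n -> {set I}).
Hypothesis decP : zero_closure_block_decomposition P r c Ls Js.

(** Pulled back along [g], a column outside the blocks is an additional one: impossible if [c = 0],
    and free of zeros otherwise. *)
Lemma decomposition_col i :
  c = 0 \/ meets_zero P (inl i) -> exists k, i \in Js k.
Proof.
case: decP => _ _ [f [g [[[f' _ ff'] [g' _ gg'] eqP'] _ gE]]] ci.
case def_b: (g' i) => [[k b]|b].
  by exists k; rewrite -(gg' i) def_b gE; apply: valP.
case: ci => [c0|/meets_zero_col[l Pli]]; first by case: b {def_b}; rewrite c0.
have := eqP' (f' l) (g' i); rewrite ff' gg' def_b /bar Pli.
by case: (f' l).
Qed.

Lemma decomposition_row l :
  r = 0 \/ meets_zero P (inr l) -> exists k, l \in Ls k.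
Proof.
case: decP => _ _ [f [g [[[f' _ ff'] [g' _ gg'] eqP'] fE _]]] ri.
case def_a: (f' l) => [[k a]|a].
  by exists k; rewrite -(ff' l) def_a fE; apply: valP.
case: ri => [r0|/meets_zero_row[i Pli]]; first by case: a {def_a}; rewrite r0.
by have := eqP' (f' l) (g' i); rewrite ff' gg' def_a /bar Pli.
Qed.

Hypothesis P_regular : regular_matrix P.
Hypothesis P_zero : exists l i, P l i = None.

Lemma is_commuting_component_isolated i l :
  ~~ (meets_zero P (inl i) && meets_zero P (inr l)) ->
  is_commuting_component (rees0_block P [set i] [set l]).
Proof.
move=> iso; exists (Some (i, 1%g, l) : rees0 P); first exact: elt_vertex.
apply/setP=> b; rewrite [RHS]inE cconn_isolatedP // rees0_vertices //.
by case: b => [[[j y] m]|]; rewrite !inE.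
Qed.

(** Block [k] is the zero-graph component of [i] and block [m] that of [l], so [same_cell] becomes
    membership in the union. The case [k = m] is allowed and yields the diagonal blocks. *)
Lemma block_component k m i x l : i \in Js k -> l \in Ls m ->
  [set b in commuting_vertices (rees0 P) |
     connect (@commuting_adj (rees0 P)) (Some (i, x, l) : rees0 P) b] =
  rees0_block P (Js k) (Ls m) :|: rees0_block P (Js m) (Ls k).
Proof.
case: decP => clo _ _ ik lm; have symE := zero_graph_sym P.
have [i1 [l1 [Pli1 JkE LkE]]] := zero_closure_submatrix_connect (clo k).
have [i2 [l2 [Pli2 JmE LmE]]] := zero_closure_submatrix_connect (clo m).
have zi : meets_zero P (inl i).
  rewrite JkE in ik; apply: meets_zero_connect ik.
  by apply/meets_zero_col; exists l1.
have zl : meets_zero P (inr l).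
  rewrite LmE in lm; apply: meets_zero_connect lm.
  by apply/meets_zero_col; exists l2.
apply/setP=> -[[[j y] q]|]; rewrite [LHS]inE cconnP // rees0_vertices // !inE //.
rewrite /same_cell JkE LkE JmE LmE.
rewrite JkE in ik; rewrite LmE in lm.
rewrite -!(same_connect symE ik) -!(same_connect symE lm) /=.
by congr (_ || _); rewrite andbC.
Qed.

Lemma is_commuting_component_blocks k m :
  is_commuting_component
    (rees0_block P (Js k) (Ls m) :|: rees0_block P (Js m) (Ls k)).
Proof.
case: (decP) => clo _ _.
have [i1 [l1 [Pli1 JkE LkE]]] := zero_closure_submatrix_connect (clo k).
have [i2 [l2 [Pli2 JmE LmE]]] := zero_closure_submatrix_connect (clo m).
exists (Some (i1, 1%g, l2) : rees0 P); first exact: elt_vertex.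
symmetry; apply: block_component; rewrite ?JkE ?LmE ?connect0 //.
by apply: connect1; rewrite /= Pli2.
Qed.

Lemma commuting_component_cases (C : {set rees0 P}) :
  is_commuting_component C ->
  (exists i l, ~~ (meets_zero P (inl i) && meets_zero P (inr l)) /\
     C = rees0_block P [set i] [set l]) \/
  (exists k m,
     C = rees0_block P (Js k) (Ls m) :|: rees0_block P (Js m) (Ls k)).
Proof.
case=> -[[[i x] l]|]; last by rewrite rees0_vertices.
move=> _ ->; have [/andP[zi zl]|iso] :=
  boolP (meets_zero P (inl i) && meets_zero P (inr l)).
  have [k ik] := decomposition_col (or_intror zi).
  have [m lm] := decomposition_row (or_intror zl).
  by right; exists k, m; apply: block_component.
left; exists i, l; split=> //; apply/setP=> b.
rewrite [LHS]inE cconn_isolatedP // rees0_vertices //.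
by case: b => [[[j y] m]|]; rewrite !inE.
Qed.

(** A zero entry gives a block. The only shape left to exclude is one block filling all of [P],
    where [block_component] would make the commuting graph connected. *)
Lemma disconnected_block_form :
  ~ commuting_graph_connected (rees0 P) -> block_form n r c.
Proof.
move=> disc; have n_gt0 : 0 < n.
  have [l [i Pli]] := P_zero.
  have [|k _] := @decomposition_col i; last exact: leq_ltn_trans (ltn_ord k).
  by right; apply/meets_zero_col; exists l.
have [r0|r_gt0] := posnP r; have [c0|c_gt0] := posnP c.
- constructor 1; split=> //; rewrite ltnNge; apply/negP=> n_le1; case: disc.
  have eqI (k m : 'I_n) : k = m.
    apply: val_inj; case: k m => [k ltk] [m ltm] /=.
    by case: k m ltk ltm (leq_trans ltk n_le1) => [|k] [|m] //= _ ltm _;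
      have := leq_trans ltm n_le1.
  move=> [[[i x] l]|] [[[j y] m]|]; rewrite !rees0_vertices // => _ _.
  have [k ik] := decomposition_col (i := i) (or_introl c0).
  have [k1 lk] := decomposition_row (l := l) (or_introl r0).
  have [k2 jk] := decomposition_col (i := j) (or_introl c0).
  have [k3 mk] := decomposition_row (l := m) (or_introl r0).
  have /setP/(_ (Some (j, y, m) : rees0 P)) := block_component x ik lk.
  by rewrite [LHS]inE rees0_vertices // !inE /= (eqI k k2) (eqI k1 k3) jk mk.
- by constructor 2.
- by constructor 3.
- by constructor 4.
Qed.

End Decomposition.

Theorem theorem4p16 (gT : finGroupType) (I Lambda : finType)
  (P : Lambda -> I -> option gT)
  (I_nonempty : 0 < #|I|) (Lambda_nonempty : 0 < #|Lambda|)
  (P_regular : regular_matrix P)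
  (P_zero : exists l i, P l i = None)
  (disconnected : ~ commuting_graph_connected (rees0 P)) :
  (exists (n r c : nat) (Ls : 'I_n -> {set Lambda}) (Js : 'I_n -> {set I}),
      block_form n r c /\ zero_closure_block_decomposition P r c Ls Js)
  /\
  (forall (n r c : nat) (Ls : 'I_n -> {set Lambda}) (Js : 'I_n -> {set I}),
      block_form n r c -> zero_closure_block_decomposition P r c Ls Js ->
      [/\ (forall k : 'I_n,
             is_commuting_component (rees0_block P (Js k) (Ls k))),
          (forall k m : 'I_n, k != m ->
             is_commuting_component
               (rees0_block P (Js k) (Ls m) :|: rees0_block P (Js m) (Ls k))),
          (forall (i : I) (l : Lambda), (forall j, P l j <> None) ->
             is_commuting_component (rees0_block P [set i] [set l])),
          (forall (i : I) (l : Lambda), (forall m, P m i <> None) ->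
             is_commuting_component (rees0_block P [set i] [set l]))
        & (forall C : {set rees0 P}, is_commuting_component C ->
             [\/ exists k : 'I_n, C = rees0_block P (Js k) (Ls k),
                 exists k m : 'I_n, k != m /\
                   C = rees0_block P (Js k) (Ls m)
                         :|: rees0_block P (Js m) (Ls k),
                 exists (i : I) (l : Lambda), (forall j, P l j <> None) /\
                   C = rees0_block P [set i] [set l]
               | exists (i : I) (l : Lambda), (forall m, P m i <> None) /\
                   C = rees0_block P [set i] [set l]])]).
Proof.
split=> [|n r c Ls Js _ decP].
  have [n [r [c [Ls [Js decP]]]]] := zero_closure_decomposition_exists P.
  exists n, r, c, Ls, Js; split=> //.
  exact: disconnected_block_form decP P_regular P_zero disconnected.
have iso := is_commuting_component_isolated P_regular P_zero.
have blocks := is_commuting_component_blocks decP P_regular P_zero.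
split=> [k|k m _|i l nz|i l nz|C].
- by have := blocks k k; rewrite setUid.
- exact: blocks.
- by apply: iso; apply/andP=> -[_ /meets_zero_row[j]]; apply: nz.
- by apply: iso; apply/andP=> -[/meets_zero_col[m] + _]; apply: nz.
case/(commuting_component_cases decP P_regular P_zero).
  (* An isolated column falls under case (4) of the theorem, an isolated row under case (3). *)
  move=> [i [l [/nandP[niz|nlz] ->]]]; [constructor 4 | constructor 3];
    exists i, l; split=> // t Pt.
    by case/meets_zero_col: niz; exists t.
  by case/meets_zero_row: nlz; exists t.
move=> [k [m ->]]; have [->|neq] := eqVneq k m.
  by constructor 1; exists m; rewrite setUid.
by constructor 2; exists k, m.
Qed.
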